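(* For every fixed $B>0$ and every fixed positive odd integer $h$, for all sufficiently large $x$, $$S_h^\varphi(x)\ll_{B,h}x\exp\{-BG\}.$$ More generally, after choosing a fixed integer $J>B^2$, the estimate is uniform for positive odd integers $h\le e^{G/\sqrt J}$.
   Context: $\varphi$ is Euler's totient function; $\log_j x$ is the $j$-fold iterated logarithm; $G=(\log x\cdot\mathcal A)^{1/2}$ with $\mathcal A=\log_3 x+\log_4 x-\log 2$ ($x$ is large enough that this is defined and $\mathcal A>0$); $S_h^\varphi(x)=\#\{n\le x:\varphi(n)=\varphi(n+h)\}$ with $n$ a positive integer. *)

(* Defs.v *)
From mathcomp Require Import all_boot all_order all_algebra.
From mathcomp Require Import all_classical all_reals all_analysis.

Set Implicit Arguments.
Unset Strict Implicit.
Unset Printing Implicit Defensive.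

Import Order.TTheory GRing.Theory Num.Theory.

Local Open Scope ring_scope.

(* The j-fold iterated natural logarithm; since [ln] is total with value 0 on
   nonpositive arguments, this is the usual log_j x only once x is large
   enough for log_j x to be defined. *)
Definition iter_ln (R : realType) (j : nat) (x : R) : R := iter j (@ln R) x.

Definition calA (R : realType) (x : R) : R := iter_ln 3 x + iter_ln 4 x - ln 2.

Definition bigG (R : realType) (x : R) : R := Num.sqrt (ln x * calA x).

(* [Num.truncn x] is the floor of x for 0 <= x, so the ordinals below its
   successor are exactly the natural numbers n <= x. *)
Definition Sphi (R : realType) (h : nat) (x : R) : nat :=
  #|[set n : 'I_(Num.truncn x).+1 | (0 < n)%N && (totient n == totient (n + h)%N)]|.

(* Main.v *)
Require Import Defs.
From mathcomp Require Import all_boot all_order all_algebra.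
From mathcomp Require Import all_classical all_reals all_analysis.
From mathcomp Require Import zify ring lra.

(* Write w(n) for the number of primes dividing n, x for the bound and G for the
   target exponent. Up to O(x exp(-BG)) exceptions, w(n) and w(n + h) are at most
   k ~ K G / log log x (a moment of the divisor function), n is not small, and no
   d^2 with d >= Y = exp(O(G)) divides n or n + h. Since (log x)^k = exp(O(G)) and
   x^(1/k) exceeds every power of exp G (because A = o(log log x)), this forces
   n = m p and n + h = m' p' with primes p, p' >= Y. Put t = gcd(p - 1, p' - 1),
   p = s t + 1, p' = s' t + 1; then totient m * s = totient m' * s', so s' divides
   totient m. By symmetry let s' <= s.
   - If s >= S = exp(O(G)): p' is known from (s', t) and p' | n + h determines s
     modulo p' once m is given, so (m, s', t, s / p') determines n. The number of
     such codes is O(x / S) times logarithms times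
     sum_(w(m) <= k) tau(totient m) / m <= (log x)^(O(k)) = exp(O(G)).
   - If s < S and m >= Y: n is known modulo p p' from (s, s', t).
   - If s < S and m < Y: m' is small too, and (m, m') determines (p, p') through a
     linear system whose determinant is nonzero as m, m' have different parity. *)

Import Order.TTheory GRing.Theory Num.Theory.
Import numFieldNormedType.Exports.

(** * Divisor counts and prime factors *)

Definition tau (n : nat) : nat := size (divisors n).

(** Each divisor [d] of [a * b] is the product of [gcdn d a], which divides [a], and
    [d %/ gcdn d a], which divides [b]. *)
Lemma tauM_le (a b : nat) : 0 < a -> 0 < b -> tau (a * b) <= tau a * tau b.
Proof.
move=> a0 b0; rewrite /tau -(size_allpairs muln).
apply: uniq_leq_size; first exact: divisors_uniq.
move=> d; rewrite -dvdn_divisors ?muln_gt0 ?a0 // => dvd_ab.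
have d0 : 0 < d by apply: dvdn_gt0 dvd_ab; rewrite muln_gt0 a0.
have g0 : 0 < gcdn d a by rewrite gcdn_gt0 d0.
apply/allpairsP; exists (gcdn d a, d %/ gcdn d a) => /=; split.
- by rewrite -dvdn_divisors // dvdn_gcdr.
- rewrite -dvdn_divisors // -(@Gauss_dvdr _ (a %/ gcdn d a)).
    by rewrite -(dvdn_pmul2l g0) mulnA !(mulnC (gcdn d a)) !divnK
      ?dvdn_gcdl ?dvdn_gcdr.
  by rewrite /coprime -(eqn_pmul2l g0) muln_gcdr !(mulnC (gcdn d a))
    !divnK ?dvdn_gcdl ?dvdn_gcdr // mul1n.
- by rewrite mulnC divnK ?dvdn_gcdl.
Qed.

Lemma size_primes_partC (p n : nat) : p \in primes n ->
  size (primes n) = (size (primes n`_p^')).+1.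
Proof.
move=> pn; rewrite primes_part size_filter -(count_predC [in p^']) -addn1; congr (_ + _).
rewrite (@eq_count _ _ (pred1 p)); last by move=> q; rewrite !inE negbK.
by rewrite (count_uniq_mem p (primes_uniq n)) pn.
Qed.

(** Strip the full power of a prime [p] from [n], leaving [m]: the divisors of [m] and their
    multiples by [p] are distinct divisors of [n], so each prime doubles the count. *)
Lemma leq_exp2_tau (n : nat) : 0 < n -> 2 ^ size (primes n) <= tau n.
Proof.
elim/ltn_ind: n => n IH n0.
have [n1|n1] := leqP n 1; first by have -> : n = 1 by lia.
have pn : pdiv n \in primes n by rewrite mem_primes pdiv_prime // n0 pdiv_dvd.
set p := pdiv n in pn.
have p_pr : prime p by apply: pdiv_prime.
rewrite (size_primes_partC _ _ pn) expnS mul2n -addnn.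
set m := n`_p^'.
have m0 : 0 < m by apply: part_gt0.
have nE : n = p ^ logn p n * m by rewrite -p_part /m partnC.
have e0 : 0 < logn p n by rewrite logn_gt0.
have pm : ~~ (p %| m) by rewrite -p'natE // part_pnat.
have ltmn : m < n.
  rewrite [ltnRHS]nE -[ltnLHS]mul1n ltn_pmul2r //.
  by rewrite -(exp1n (logn p n)) ltn_exp2r // prime_gt1.
have {}IH := IH m ltmn m0.
apply: (leq_trans (leq_add IH IH)).
have -> : tau m + tau m = size (divisors m ++ [seq p * d | d <- divisors m]).
  by rewrite size_cat size_map.
apply: uniq_leq_size.
  rewrite cat_uniq divisors_uniq map_inj_uniq ?divisors_uniq ?andbT /=; last first.
    by move=> x y /eqP; rewrite eqn_pmul2l ?prime_gt0 // => /eqP.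
  apply/hasPn => _ /mapP[d dm ->]; rewrite -dvdn_divisors //.
  by apply: contra pm; apply: dvdn_trans; exact: dvdn_mulr.
move=> d; rewrite -dvdn_divisors // mem_cat => /orP[|].
  by rewrite -dvdn_divisors // => dm; rewrite nE dvdn_mull.
case/mapP => e; rewrite -dvdn_divisors // => em ->.
by rewrite nE dvdn_mul // -{1}(expn1 p) dvdn_exp2l.
Qed.

(* A power p ^ v || n with v >= 2 and p ^ v > Y ^ 3 would give the square divisor
   (p ^ (v / 2)) ^ 2 with p ^ (v / 2) >= Y. *)
Lemma exists_large_prime_factor (Y k n : nat) : 0 < n -> size (primes n) <= k ->
  Y ^ (3 * k) < n -> (forall d, Y <= d -> ~~ (d ^ 2 %| n)) ->
  exists p m, [/\ prime p, Y <= p, n = m * p, coprime p m & size (primes m) <= k].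
Proof.
move=> n0 nk Yn nsq.
have [Y_eq0|Y0] := posnP Y.
  by have := nsq 1; rewrite Y_eq0 exp1n dvd1n => /(_ isT).
have [p pn lt_p] : exists2 p, p \in primes n & Y ^ 3 < p ^ logn p n.
  (* If all of the at most [k] prime powers exactly dividing [n] were at most [Y ^ 3], their product
     [n] would be at most [Y ^ (3 * k)]. *)
  apply/hasP; apply: contraLR Yn; rewrite -all_predC -leqNgt => /allP small.
  rewrite {1}(prod_prime_decomp n0) prime_decompE big_map /=.
  apply: (@leq_trans (\prod_(p <- primes n) Y ^ 3)).
    rewrite big_seq [leqRHS]big_seq; apply: leq_prod => p pn.
    by have := small p pn; rewrite /= -leqNgt.
  by rewrite big_const_seq iter_muln_1 count_predT -expnM leq_pexp2l // leq_mul2l.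
have p_pr : prime p by move: pn; rewrite mem_primes => /andP[].
set v := logn p n in lt_p.
have v0 : 0 < v by rewrite logn_gt0.
have v1 : v = 1.
  apply/eqP; rewrite eqn_leq v0 andbT leqNgt; apply/negP => v2.
  have /negP[] : ~~ ((p ^ v./2) ^ 2 %| n).
    apply: nsq; rewrite -(leq_exp2r _ _ (isT : 0 < 3)).
    apply: (leq_trans (ltnW lt_p)); rewrite -expnM leq_pexp2l ?prime_gt0 //.
    by lia.
  by rewrite -expnM pfactor_dvdn // -/v; lia.
exists p, n`_p^'; split => //.
- rewrite v1 expn1 in lt_p; apply: leq_trans (ltnW lt_p).
  by rewrite -{1}(expn1 Y) leq_pexp2l.
- by rewrite -[LHS](partnC p n0) p_part -/v v1 expn1 mulnC.
- by rewrite prime_coprime // -p'natE // part_pnat.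
- by apply: leq_trans nk; rewrite (size_primes_partC _ _ pn).
Qed.

(** * The ratio of an integer to its totient *)

(** Euler's product for [totient m / m] with denominators cleared. *)
Lemma totient_radical (m : nat) : 0 < m ->
  totient m * \prod_(p <- primes m) p = m * \prod_(p <- primes m) p.-1.
Proof.
move=> m0; rewrite totientE // [X in _ = X * _](prod_prime_decomp m0) prime_decompE big_map.
rewrite -!big_split /= !big_seq; apply: eq_bigr => p pm.
by rewrite -mulnA -expnSr prednK ?logn_gt0 // mulnC.
Qed.

Lemma prime_dvd_prod (q : nat) (s : seq nat) (P : pred nat) (F : nat -> nat) :
  prime q -> q %| \prod_(p <- s | P p) F p ->
  exists p, [/\ p \in s, P p & q %| F p].
Proof.
move=> q_pr; elim: s => [|p s IH]; first by rewrite big_nil dvdn1; case: q q_pr => [|[]].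
rewrite big_cons; case: ifP => Pp; last first.
  by move/IH => [r [rs Pr qr]]; exists r; rewrite inE rs orbT.
rewrite Euclid_dvdM // => /orP[qp|/IH[r [rs Pr qr]]].
  by exists p; rewrite inE eqxx.
by exists r; rewrite inE rs orbT.
Qed.

(* The ratio m / totient m = prod p / (p - 1) determines the primes dividing m
   from the largest downwards, since q divides no p - 1 with p <= q. *)
Lemma eq_primes_totient_ratio (m m' : nat) : 0 < m -> 0 < m' ->
  totient m * m' = totient m' * m -> primes m =i primes m'.
Proof.
move=> m0 m'0 eq_ratio.
have rad_gt0 n : 0 < \prod_(p <- primes n) p.
  rewrite big_seq; apply: prodn_cond_gt0 => p.
  by rewrite mem_primes => /andP[/prime_gt0].
have eq_prod : (\prod_(p <- primes m) p.-1) * (\prod_(p <- primes m') p) =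
               (\prod_(p <- primes m') p.-1) * (\prod_(p <- primes m) p).
  have := totient_radical _ m0; have := totient_radical _ m'0.
  move: (\prod_(_ <- _) _.-1) (\prod_(_ <- primes m) _.-1) => b' b.
  move: (rad_gt0 m) (rad_gt0 m').
  move: (\prod_(_ <- primes m) _) (\prod_(_ <- primes m') _) => a a' a0 a'0 e' e.
  apply/eqP; rewrite -(eqn_pmul2l m0) -(eqn_pmul2l m'0); apply/eqP.
  transitivity (m' * (m * b) * a'); first by ring.
  rewrite -e; transitivity ((totient m * m') * a * a'); first by ring.
  rewrite eq_ratio; transitivity (m * (totient m' * a') * a); first by ring.
  by rewrite e'; ring.
pose N := (maxn m m').+1.
have big_notin q n : n <= maxn m m' -> N <= q -> q \notin primes n.
  move=> nN Nq; apply/negP; rewrite mem_primes => /and3P[_ n0 /dvdn_leq].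
  by move/(_ n0); rewrite /N in Nq; lia.
(* Downward induction on [q], run on the distance [N - q]: from [N] on, neither number has a prime
   factor. *)
suff key d q : N - q <= d -> (q \in primes m) = (q \in primes m').
  by move=> q; apply: (key (N - q) q).
elim: d q => [|d IH] q.
  by rewrite leqn0 subn_eq0 => Nq; rewrite !(negPf (big_notin _ _ _ Nq)) ?leq_max ?leqnn ?orbT.
move=> Nq.
have [q_pr|] := boolP (prime q); last first.
  by move=> q_npr; rewrite !mem_primes (negPf q_npr).
have q0 := prime_gt0 q_pr.
have dvd_rad n : (q %| \prod_(p <- primes n) p) = (q \in primes n).
  apply/idP/idP => [/(prime_dvd_prod _ _ predT) | qn].
    case/(_ q_pr) => p [pn _]; rewrite dvdn_prime2 // => [/eqP-> //|].
    by move: pn; rewrite mem_primes => /andP[].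
  by rewrite (big_rem q) //= dvdn_mulr.
have eq_above : \prod_(p <- primes m | q < p) p.-1 = \prod_(p <- primes m' | q < p) p.-1.
  rewrite -[LHS]big_filter -[RHS]big_filter; apply: perm_big.
  apply: uniq_perm; rewrite ?filter_uniq ?primes_uniq // => p.
  by rewrite !mem_filter; case: ltnP => //= qp; apply: IH; lia.
have above_gt0 n : 0 < \prod_(p <- primes n | q < p) p.-1.
  by apply: prodn_cond_gt0 => p; lia.
have below n : ~~ (q %| \prod_(p <- primes n | ~~ (q < p)) p.-1).
  apply/negP => /(prime_dvd_prod _ _ _ _ q_pr)[p [pn]].
  have p1 : 1 < p by move: pn; rewrite mem_primes => /andP[/prime_gt1].
  by rewrite -leqNgt => pq /dvdn_leq; lia.
(* The equal factors from primes above [q] cancel. Then [q] divides the left side exactly when it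
   divides [m'], and the right side exactly when it divides [m]. *)
move: eq_prod; rewrite (bigID (fun p => q < p)) /= eq_above.
rewrite [X in _ = X * _](bigID (fun p => q < p)) /= -!mulnA => /eqP.
rewrite (eqn_pmul2l (above_gt0 m')) => /eqP/(congr1 (dvdn q)).
by rewrite !Euclid_dvdM // !(negPf (below _)) /= !dvd_rad.
Qed.

(** * Counting solutions of a predicate *)

(** Bounding all duplicate-free lists of solutions gives a cardinality bound that presupposes
    neither finiteness nor decidability, so [P] may be an existential over factorizations. *)
Definition at_most (R : numDomainType) (P : nat -> Prop) (b : R) : Prop :=
  forall s : seq nat, uniq s -> (forall n, n \in s -> P n) ->
  ((size s)%:R <= b)%R.

Lemma at_most_or (R : numDomainType) (P Q1 Q2 : nat -> Prop) (b1 b2 : R) :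
  (forall n, P n -> Q1 n \/ Q2 n) ->
  at_most R Q1 b1 -> at_most R Q2 b2 -> at_most R P (b1 + b2)%R.
Proof.
move=> PQ atQ1 atQ2 s us sP; rewrite -(count_predC (fun n => `[< Q1 n >]) s).
rewrite natrD -!size_filter; apply: lerD.
  by apply: atQ1; rewrite ?filter_uniq // => n; rewrite mem_filter => /andP[/asboolP].
apply: atQ2; rewrite ?filter_uniq // => n; rewrite mem_filter => /andP[/asboolPn nQ1].
by move=> /sP/PQ[].
Qed.

Lemma at_most_shift (R : numDomainType) (Q : nat -> Prop) (h : nat) (b : R) :
  at_most R Q b -> at_most R (fun n => Q (n + h)) b.
Proof.
move=> atQ s us sQ; rewrite -(size_map (addn^~ h)); apply: atQ.
  by rewrite map_inj_uniq // => x y; lia.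
by move=> _ /mapP[n ns ->]; exact: sQ.
Qed.

Lemma at_most_le (R : numDomainType) (P Q : nat -> Prop) (b c : R) :
  (forall n, P n -> Q n) -> (b <= c)%R -> at_most R Q b -> at_most R P c.
Proof.
move=> PQ bc atQ s us sP; apply: le_trans bc; apply: atQ => // n ns.
exact/PQ/sP.
Qed.

(** The injection into [C] is given as a relation, so that no code has to be chosen as a function of
    [n]. *)
Lemma at_most_code (R : numDomainType) (U : eqType) (C : seq U)
    (P : nat -> Prop) (rel : nat -> U -> Prop) :
  (forall n, P n -> exists2 c, c \in C & rel n c) ->
  (forall n n' c, rel n c -> rel n' c -> n = n') ->
  at_most R P (size C)%:R.
Proof.
move=> codeP rel_inj s us sP; rewrite ler_nat.
suff [t [<- ut tC _]] : exists t : seq U, [/\ size t = size s, uniq t,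
    {subset t <= C} & forall c, c \in t -> exists2 n, n \in s & rel n c].
  exact: uniq_leq_size.
elim: s us sP => [|n s IH]; first by exists [::].
rewrite cons_uniq => /andP[ns us] sP.
have [|t [tsize ut tC tP]] := IH us; first by move=> i si; apply: sP; rewrite inE si orbT.
have [c cC nc] := codeP n (sP n (mem_head _ _)).
exists (c :: t); split.
- by rewrite /= tsize.
- rewrite cons_uniq ut andbT; apply/negP => /tP[i si ic].
  by move: ns; rewrite (rel_inj _ _ _ nc ic) si.
- by move=> d; rewrite inE => /predU1P[->|/tC].
- move=> d; rewrite inE => /predU1P[->|/tP[i si id]].
    by exists n; rewrite ?mem_head.
  by exists i; rewrite // inE si orbT.
Qed.

(** * Sums over divisors and moments of [tau] *)

Lemma ler_sum_inj (R : numDomainType) (I J : eqType) (s : seq I) (r : seq J)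
    (f : I -> J) (F : I -> R) (G : J -> R) :
  uniq s -> {in s &, injective f} ->
  (forall i, i \in s -> f i \in r /\ (F i <= G (f i))%R) ->
  (forall j, j \in r -> (0 <= G j)%R) ->
  (\sum_(i <- s) F i <= \sum_(j <- r) G j)%R.
Proof.
elim: s r => [|i s IH] r.
  by move=> _ _ _ G0; rewrite big_nil big_seq; apply: sumr_ge0.
rewrite cons_uniq => /andP[ins us] f_inj FG G0.
have [fir FGi] := FG i (mem_head _ _).
rewrite big_cons (big_rem _ fir) /=; apply: lerD => //.
apply: IH => //.
- by move=> x y xs ys; apply: f_inj; rewrite inE ?xs ?ys orbT.
- move=> x xs; have [|fxr FGx] := FG x; first by rewrite inE xs orbT.
  split=> //; move: fxr; rewrite (perm_mem (perm_to_rem fir)) inE => /predU1P[|//].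
  move/f_inj; rewrite !inE xs eqxx orbT => /(_ isT isT) xi.
  by move: ins; rewrite -xi xs.
- by move=> j /mem_rem; exact: G0.
Qed.

Lemma mem_index_iota1 (n X : nat) : (n \in index_iota 1 X.+1) = (0 < n <= X).
Proof. by rewrite mem_index_iota ltnS. Qed.

(** An integer [n] with a divisor [d] is recovered from the pair [(d, n %/ d)], both entries of
    which lie between 1 and [X]. *)
Lemma sum_divisors_le (R : numDomainType) (X : nat) (G : nat -> nat -> R) :
  (forall d e, (0 <= G d e)%R) ->
  (\sum_(1 <= n < X.+1) \sum_(d <- divisors n) G d (n %/ d)%N <=
   \sum_(1 <= d < X.+1) \sum_(1 <= e < X.+1) G d e)%R.
Proof.
move=> G0.
have sum_pairs (t : nat -> seq nat) (h : nat -> nat -> nat * nat) :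
    (\sum_(1 <= n < X.+1) \sum_(d <- t n) G (h n d).1 (h n d).2 =
     \sum_(c <- [seq h n d | n <- index_iota 1 X.+1, d <- t n]) G c.1 c.2)%R.
  by rewrite big_allpairs_dep.
rewrite (sum_pairs _ (fun n d => (d, n %/ d))) (sum_pairs (fun=> _) pair).
apply: (@ler_sum_inj _ _ _ _ _ id) => //.
- apply: allpairs_uniq_dep; rewrite ?iota_uniq //; first by move=> n _; exact: divisors_uniq.
  move=> _ _ /allpairsPdep[n [d [nX dn ->]]] /allpairsPdep[n' [d' [n'X dn' ->]]] /=.
  move: nX n'X dn dn'; rewrite !mem_index_iota1 => /andP[n0 _] /andP[n'0 _].
  rewrite -!dvdn_divisors // => dn dn' [edd eq_div].
  by rewrite -(divnK dn) -(divnK dn') eq_div edd.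
- move=> _ /allpairsPdep[n [d [nX dn ->]]]; split=> //.
  move: nX dn; rewrite mem_index_iota1 => /andP[n0 nX].
  rewrite -dvdn_divisors // => dn; have d0 := dvdn_gt0 n0 dn.
  apply: allpairs_f; rewrite mem_index_iota1.
    by rewrite d0 (leq_trans (dvdn_leq n0 dn)).
  by rewrite divn_gt0 // (dvdn_leq n0 dn) (leq_trans (leq_div _ _)).
Qed.

(** Each of the [l] dyadic blocks contributes at most 1. *)
Lemma harmonic_sum_le (R : realFieldType) (l X : nat) : X < 2 ^ l ->
  (\sum_(1 <= n < X.+1) n%:R^-1 <= l%:R :> R)%R.
Proof.
move=> Xl; apply: (@le_trans _ _ (\sum_(1 <= n < 2 ^ l) n%:R^-1)%R).
  rewrite (big_cat_nat (isT : 1 <= X.+1) Xl) /= lerDl.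
  by apply: sumr_ge0 => n _; rewrite invr_ge0 ler0n.
elim: l {X Xl} => [|l IH]; first by rewrite expn0 big_geq.
have lt2 : 2 ^ l <= 2 ^ l.+1 by rewrite leq_exp2l.
rewrite (big_cat_nat _ lt2) ?expn_gt0 //= -natr1; apply: lerD => //.
apply: (@le_trans _ _ (\sum_(2 ^ l <= n < 2 ^ l.+1) (2 ^ l)%:R^-1)%R).
  rewrite big_nat [leRHS]big_nat; apply: ler_sum => n /andP[ln _].
  by rewrite lef_pV2 ?posrE ?ltr0n ?ler_nat ?expn_gt0 // (leq_trans _ ln) ?expn_gt0.
rewrite sumr_const_nat expnS mul2n -addnn addnK.
by rewrite -[leLHS]mulr_natr mulVf // pnatr_eq0 -lt0n expn_gt0.
Qed.

(** One factor [tau n] is written as a sum over [d %| n], and submultiplicativity splits the rest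
    between [d] and [n %/ d]. So the moment of order [j.+1] is at most the square of that of order
    [j]. *)
Lemma tau_moment_le (R : realFieldType) (j l X : nat) : X < 2 ^ l ->
  (\sum_(1 <= n < X.+1) (tau n)%:R ^+ j / n%:R <= l%:R ^+ (2 ^ j) :> R)%R.
Proof.
move=> Xl; elim: j => [|j IH].
  rewrite expn0 expr1; apply: le_trans (harmonic_sum_le R _ _ Xl).
  by apply: ler_sum => n _; rewrite expr0 mul1r.
pose g n : R := ((tau n)%:R ^+ j / n%:R)%R.
have g0 n : (0 <= g n)%R by rewrite divr_ge0 ?exprn_ge0 ?ler0n.
apply: (@le_trans _ _ (\sum_(1 <= n < X.+1) \sum_(d <- divisors n) g d * g (n %/ d)%N)%R).
  rewrite big_seq [leRHS]big_seq; apply: ler_sum => n; rewrite mem_index_iota1.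
  case/andP=> n0 _.
  have -> : ((tau n)%:R ^+ j.+1 / n%:R = \sum_(d <- divisors n) g n)%R.
    by rewrite big_const_seq count_predT iter_addr_0 /g exprS -mulrA mulr_natl.
  rewrite big_seq [leRHS]big_seq; apply: ler_sum => d; rewrite -dvdn_divisors // => dn.
  have d0 := dvdn_gt0 n0 dn; have nd0 : (0 < n %/ d)%N by rewrite divn_gt0 // (dvdn_leq n0 dn).
  have -> : (g d * g (n %/ d)%N = (tau d * tau (n %/ d))%:R ^+ j / n%:R)%R.
    by rewrite /g mulrACA -invfM -exprMn -!natrM [(d * _)%N]mulnC divnK.
  rewrite /g ler_wpM2r ?invr_ge0 ?ler0n // lerXn2r ?nnegrE ?ler0n // ler_nat.
  by rewrite -{1}(divnK dn) mulnC tauM_le.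
apply: le_trans (sum_divisors_le _ X (fun d e => g d * g e)%R _) _.
  by move=> d e; rewrite mulr_ge0.
under eq_bigr do rewrite -mulr_sumr.
rewrite -mulr_suml expnS mulnC exprM -expr2.
by rewrite lerXn2r ?nnegrE ?exprn_ge0 ?ler0n // sumr_ge0.
Qed.

Lemma tau_pfactor_le (p e : nat) : prime p -> tau (p ^ e) <= e.+1.
Proof.
move=> p_pr; rewrite -[leqRHS](size_iota 0) -(size_map (expn p)).
apply: uniq_leq_size; first exact: divisors_uniq.
move=> d; rewrite -dvdn_divisors ?expn_gt0 ?prime_gt0 // => /(dvdn_pfactor _ _ p_pr)[i ie ->].
by rewrite map_f // mem_iota.
Qed.

(** With [a = logn p m], [totient m] is [p.-1 * p ^ a.-1] times the totient of the part prime to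
    [p]; the factor [p ^ a.-1] has at most [a] divisors. *)
Lemma tau_totient_partC_le (p m : nat) : p \in primes m ->
  tau (totient m) <= logn p m * tau p.-1 * tau (totient m`_p^').
Proof.
move=> pm; move: (pm); rewrite mem_primes => /and3P[p_pr m0 _].
have p1 := prime_gt1 p_pr; have a0 : 0 < logn p m by rewrite logn_gt0.
rewrite -{1}(partnC p m0) totient_coprime ?coprime_partC // p_part totient_pfactor //.
apply: (leq_trans (tauM_le _ _ _ _)); rewrite ?muln_gt0 ?expn_gt0 ?totient_gt0 ?part_gt0 //; try lia.
rewrite leq_mul2r; apply/orP; right.
apply: (leq_trans (tauM_le _ _ _ _)); rewrite ?expn_gt0; try lia.
rewrite mulnC leq_mul2r; apply/orP; right.
by apply: leq_trans (tau_pfactor_le _ _ p_pr) _; rewrite prednK.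
Qed.

(** Induction on [k], splitting off the smallest prime power [p ^ a] of each [m] with [k.+1] primes.
    The integer [u = p - 1] costs the sum of [tau u / u], at most [l ^ 2]; the choice of [a] and the
    factor [a] from [tau] cost [l] each, which makes [l ^ 4]. *)
Lemma sum_tau_totient_le (R : realFieldType) (k l X : nat) : X < 2 ^ l ->
  (\sum_(1 <= m < X.+1 | (size (primes m) <= k)%N) (tau (totient m))%:R / m%:R
     <= (1 + l%:R ^+ 4) ^+ k :> R)%R.
Proof.
move=> Xl; elim: k => [|k IH].
  rewrite expr0; apply: (@le_trans _ _ (\sum_(m <- [:: 1]) 1%R)%R); last by rewrite big_seq1.
  rewrite -big_filter; apply: (@ler_sum_inj _ _ _ _ _ id) => //.
    by rewrite filter_uniq ?iota_uniq.
  move=> m; rewrite mem_filter mem_index_iota1 leqn0 size_eq0 primes_eq0.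
  case/andP=> m2 /andP[m0 _]; have -> : m = 1 by lia.
  by rewrite mem_head divr1.
set F := (X in (X <= _)%R) in IH.
have F0 : (0 <= F)%R by apply: sumr_ge0 => m _; rewrite divr_ge0 ?ler0n.
rewrite (bigID (fun m => (size (primes m) <= k)%N)) /= exprS mulrDl mul1r.
have le_first : (\sum_(1 <= m < X.+1 | (size (primes m) <= k.+1)%N && (size (primes m) <= k)%N)
    (tau (totient m))%:R / m%:R <= F)%R.
  rewrite /F [leLHS]big_mkcond [leRHS]big_mkcond; apply: ler_sum => m _ /=.
  by have [mk|] := leqP (size (primes m)) k; rewrite ?(leqW mk) // andbF.
apply: lerD; first exact: le_trans le_first IH.
pose g (m : nat) : R := ((tau (totient m))%:R / m%:R)%R.
(* A triple [c] is [((u, a), m)]; the factor [l] majorizes the exponent [a], and [u] is allowed to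
   run over all integers, not just those of the form [p - 1]. *)
pose G (c : nat * nat * nat) : R := (l%:R * ((tau c.1.1)%:R / c.1.1%:R) * g c.2)%R.
pose ua := [seq (u, a) | u <- index_iota 1 X.+1, a <- index_iota 1 l.+1].
pose r := [seq (c, m) | c <- ua, m <- [seq m <- index_iota 1 X.+1 | size (primes m) <= k]].
apply: (@le_trans _ _ (\sum_(c <- r) G c)%R); last first.
  rewrite big_allpairs_dep /G /=; under eq_bigr do rewrite -mulr_sumr big_filter.
  rewrite -mulr_suml big_allpairs_dep /=.
  apply: (@le_trans _ _ (l%:R ^+ 4 * F)%R); last by rewrite ler_wpM2l ?exprn_ge0 ?ler0n.
  rewrite ler_wpM2r //.
  have -> : (\sum_(1 <= u < X.+1) \sum_(1 <= a < l.+1) l%:R * ((tau u)%:R / u%:R) =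
      (\sum_(1 <= u < X.+1) (tau u)%:R / u%:R) * (l%:R * l%:R) :> R)%R.
    rewrite mulr_suml; apply: eq_bigr => u _.
    by rewrite sumr_const_nat subn1 /= -[LHS]mulr_natr; ring.
  have -> : (l%:R ^+ 4 = l%:R ^+ (2 ^ 1) * (l%:R * l%:R) :> R)%R by ring.
  rewrite ler_wpM2r ?mulr_ge0 ?ler0n //.
  by apply: le_trans (tau_moment_le R 1 _ _ Xl); under [leRHS]eq_bigr do rewrite expr1.
rewrite -big_filter.
pose f m := ((pdiv m).-1, logn (pdiv m) m, m`_(pdiv m)^').
have sP m : m \in [seq m <- index_iota 1 X.+1 |
    (size (primes m) <= k.+1) && ~~ (size (primes m) <= k)] ->
    [/\ size (primes m) <= k.+1, 0 < m, m <= X & pdiv m \in primes m].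
  rewrite mem_filter mem_index_iota1 -ltnNge => /andP[/andP[mk1 mk] /andP[m0 mX]].
  split=> //; rewrite mem_primes pdiv_dvd m0 pdiv_prime //.
  by rewrite ltnNge -ltnS -primes_eq0; case: (primes m) mk.
apply: (@ler_sum_inj _ _ _ _ _ f).
- by rewrite filter_uniq ?iota_uniq.
- move=> m m' /sP[_ m0 _ pm] /sP[_ m'0 _ pm'] [ep ea eq_part].
  have p0 := pdiv_gt0 m; have p'0 := pdiv_gt0 m'; have {}ep : pdiv m = pdiv m' by lia.
  rewrite -(partnC (pdiv m) m0) -(partnC (pdiv m') m'0) !p_part.
  by rewrite ea eq_part ep.
- move=> m /sP[mk m0 mX pm]; move: (pm); rewrite mem_primes => /and3P[p_pr _ pdm].
  set p := pdiv m in pm p_pr pdm *.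
  have p1 := prime_gt1 p_pr; have pleX : p <= X by rewrite (leq_trans _ mX) // dvdn_leq.
  have a0 : 0 < logn p m by rewrite logn_gt0.
  have pa_le : p ^ logn p m <= m by rewrite dvdn_leq // pfactor_dvdnn.
  have al : logn p m <= l.
    rewrite ltnW // -(ltn_exp2l _ _ (isT : 1 < 2)) (leq_ltn_trans _ Xl) //.
    by rewrite (leq_trans _ mX) // (leq_trans _ pa_le) // leq_exp2r.
  split.
    apply: allpairs_f.
      apply: allpairs_f; rewrite mem_index_iota1 -/p ?a0 //.
      by move: p1 pleX; clear; lia.
    rewrite mem_filter -ltnS -(size_primes_partC _ _ pm) mk mem_index_iota1 part_gt0 /=.
    by rewrite (leq_trans _ mX) // dvdn_leq // dvdn_part.
  rewrite /G /= /g.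
  have -> : (l%:R * ((tau p.-1)%:R / p.-1%:R) * ((tau (totient m`_p^'))%:R / (m`_p^')%:R) =
      (l * tau p.-1 * tau (totient m`_p^'))%:R / (p.-1 * m`_p^')%:R :> R)%R.
    by rewrite !natrM invfM; ring.
  apply: ler_pM; rewrite ?ler0n ?invr_ge0 //.
    rewrite ler_nat (leq_trans (tau_totient_partC_le _ _ pm)) //.
    by rewrite !leq_mul2r al !orbT.
  rewrite lef_pV2 ?posrE ?ltr0n ?muln_gt0 ?part_gt0 ?andbT //; last by lia.
  rewrite ler_nat -[leqRHS](partnC p m0) leq_mul2r; apply/orP; right.
  by rewrite p_part (leq_trans (leq_pred _)) // -{1}(expn1 p) leq_pexp2l // ltnW.
- by move=> c _; rewrite /G /g !mulr_ge0 ?invr_ge0 ?ler0n.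
Qed.

(** * Two sparse exceptional sets *)

(* Rankin's trick with the j-th moment of tau, since 2 ^ k <= tau n. *)
Lemma at_most_many_primes (R : realFieldType) (k j l X : nat) : X < 2 ^ l ->
  at_most R (fun n => 0 < n <= X /\ k < size (primes n))
    (X%:R * l%:R ^+ (2 ^ j) / 2%:R ^+ (k * j)).
Proof.
move=> Xl s us sP.
have -> : ((size s)%:R = \sum_(n <- s) 1 :> R)%R.
  by rewrite big_const_seq count_predT iter_addr_0.
have c0 : (0 <= X%:R / 2%:R ^+ (k * j) :> R)%R by rewrite divr_ge0 ?exprn_ge0 ?ler0n.
rewrite mulrAC; apply: le_trans (ler_wpM2l c0 (tau_moment_le R j _ _ Xl)).
rewrite mulr_sumr; apply: (@ler_sum_inj _ _ _ _ _ id) => // n ns.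
have [nX nk] := sP n ns; have /andP[n0 leX] := nX.
split; first by rewrite mem_index_iota1.
have pow0 : (0 < 2%:R ^+ (k * j) :> R)%R by rewrite exprn_gt0 ?ltr0n.
have le1 : (1 <= X%:R / n%:R :> R)%R by rewrite ler_pdivlMr ?ltr0n // mul1r ler_nat.
have le2 : (1 <= (tau n)%:R ^+ j / 2%:R ^+ (k * j) :> R)%R.
  rewrite ler_pdivlMr // mul1r exprM lerXn2r ?nnegrE ?exprn_ge0 ?ler0n //.
  rewrite -natrX ler_nat; apply: leq_trans (leq_exp2_tau _ n0).
  by rewrite leq_exp2l // ltnW.
rewrite [leRHS](_ : _ = (X%:R / n%:R * ((tau n)%:R ^+ j / 2%:R ^+ (k * j)))%R).
  exact: mulr_ege1.
by rewrite mulrACA [X in (_ * X)%R]mulrC mulrACA.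
Qed.

(** Telescoping: [1 / d ^ 2] is at most [2 / d - 2 / (d + 1)] for [d >= 1]. *)
Lemma sum_inv_square_le (R : realFieldType) (Y N : nat) : 0 < Y ->
  (\sum_(Y <= d < Y + N) (d%:R ^+ 2)^-1 <= 2%:R / Y%:R - 2%:R / (Y + N)%:R :> R)%R.
Proof.
move=> Y0; elim: N => [|N IH]; first by rewrite addn0 big_geq // subrr.
rewrite addnS big_nat_recr ?leq_addr //=.
apply: le_trans (lerD IH (lexx _)) _; rewrite -addrA lerD2l addrC.
have d1 : (1 <= (Y + N)%:R :> R)%R by rewrite ler1n; lia.
rewrite -(natr1 (Y + N)); move: (Y + N)%:R%R d1 => d d1.
rewrite -subr_ge0.
rewrite (_ : (_ - _)%R = ((d - 1) / (d ^+ 2 * (d + 1)))%R); last first.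
  by field; apply/andP; split; apply: lt0r_neq0; lra.
by rewrite divr_ge0 ?mulr_ge0 ?exprn_ge0 //; lra.
Qed.

Lemma at_most_square_divisor (R : realFieldType) (X Y : nat) : 0 < Y ->
  at_most R (fun n => 0 < n <= X /\ exists2 d, Y <= d & d ^ 2 %| n)
    (X%:R * (2%:R / Y%:R)).
Proof.
move=> Y0.
(* Since [d ^ 2 <= X] forces [d <= X], the range below [Y + X] contains every relevant [d]. *)
pose C := [seq (d, e) | d <- index_iota Y (Y + X), e <- index_iota 1 (X %/ d ^ 2).+1].
apply: (at_most_le _ _ _ (size C)%:R _ (fun _ P => P)); last first.
  apply: (@at_most_code _ _ _ _ (fun n c => n = c.1 ^ 2 * c.2)) => [n|n n' c -> -> //].
  case=> /andP[n0 nX] [d Yd dn]; have d0 : 0 < d by apply: leq_trans Yd.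
  exists (d, n %/ d ^ 2); last by rewrite /= mulnC divnK.
  have dX : d ^ 2 <= n by rewrite dvdn_leq.
  apply/allpairsPdep; exists d, (n %/ d ^ 2).
  by rewrite mem_index_iota1 mem_index_iota divn_gt0 ?expn_gt0 ?d0 // dX leq_div2r //; split=> //; nia.
rewrite size_allpairs_dep sumnE big_map natr_sum.
apply: (@le_trans _ _ (X%:R * \sum_(Y <= d < Y + X) (d%:R ^+ 2)^-1)%R).
  rewrite mulr_sumr big_seq [leRHS]big_seq; apply: ler_sum => d.
  rewrite mem_index_iota => /andP[Yd _].
  rewrite size_iota subn1 /= ler_pdivlMr ?exprn_gt0 ?ltr0n ?(leq_trans Y0) //.
  by rewrite -natrX -natrM ler_nat leq_trunc_div.
rewrite ler_wpM2l ?ler0n // (le_trans (sum_inv_square_le _ _ _ Y0)) //.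
by rewrite gerBl divr_ge0 ?ler0n.
Qed.

(** * Configurations and their codes *)

Definition prod_le_pairs (V : nat) : seq (nat * nat) :=
  [seq (t, q) | t <- index_iota 1 V.+1, q <- index_iota 1 (V %/ t).+1].

Lemma mem_prod_le_pairs (V t q : nat) : 0 < t -> 0 < q -> t * q <= V ->
  (t, q) \in prod_le_pairs V.
Proof.
move=> t0 q0 tqV; apply/allpairsPdep; exists t, q.
rewrite !mem_index_iota1 t0 q0 leq_divRL // mulnC tqV.
by rewrite (leq_trans _ tqV) // leq_pmulr.
Qed.

Lemma size_prod_le_pairs (R : realFieldType) (l V : nat) : V < 2 ^ l ->
  ((size (prod_le_pairs V))%:R <= V%:R * l%:R :> R)%R.
Proof.
move=> Vl; rewrite size_allpairs_dep sumnE big_map natr_sum.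
apply: le_trans (ler_wpM2l (ler0n _ _) (harmonic_sum_le R _ _ Vl)).
rewrite mulr_sumr big_seq [leRHS]big_seq; apply: ler_sum => t.
rewrite mem_index_iota1 => /andP[t0 _].
by rewrite size_iota subn1 /= ler_pdivlMr ?ltr0n // -natrM ler_nat leq_trunc_div.
Qed.

Set Implicit Arguments.

(* A solution n1 = m * p, n2 = m' * p' of totient n1 = totient n2 with
   n1 + e1 = n2 + e2, where p = s * t + 1, p' = s' * t + 1 are large primes and
   t = gcd(p - 1, p' - 1); the labelling is such that p' <= p. *)
Record config (X Y k e1 e2 m p m' p' s s' t : nat) : Prop := Config {
  config_prime : prime p;
  config_prime' : prime p';
  config_p : p = (s * t).+1;
  config_p' : p' = (s' * t).+1;
  config_Yp : Y <= p;
  config_Yp' : Y <= p';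
  config_m : 0 < m;
  config_m' : 0 < m';
  config_omega : size (primes m) <= k;
  config_ndvd : ~~ (p' %| m * p);
  config_diff : m * p + e1 = m' * p' + e2;
  config_odd : odd (m * p) != odd (m' * p');
  config_totient : totient m * s = totient m' * s';
  config_coprime : coprime s s';
  config_le : s' <= s;
  config_X : m * p <= X }.

Lemma config_gt0 X Y k e1 e2 m p m' p' s s' t :
  config X Y k e1 e2 m p m' p' s s' t -> [/\ 0 < s, 0 < s' & 0 < t].
Proof.
move=> c; have := prime_gt1 (config_prime c); have := prime_gt1 (config_prime' c).
by rewrite (config_p c) (config_p' c) !ltnS !muln_gt0 => /andP[-> ->] /andP[-> _].
Qed.

Unset Implicit Arguments.

(** Codes use the quotient plus one so that it is positive. This costs only a factor 2: a zero
    quotient is covered by [v * S <= X], and any other satisfies [q + 1 <= 2 * q]. *)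
Lemma leq_mul_succ_divn (S Y X v n d : nat) :
  S <= Y -> Y <= d -> v * S <= X -> v * n <= X -> S * (v * (n %/ d).+1) <= 2 * X.
Proof.
move=> SY Yd vS vn; have [->|q0] := posnP (n %/ d); first by nia.
have le_n := leq_trunc_div n d.
move: (n %/ d) q0 le_n => q q0 le_n.
apply: (@leq_trans (d * (v * (2 * q)))); last by nia.
by rewrite leq_mul ?(leq_trans SY) // leq_mul //; lia.
Qed.

(** The code is [(m, s', t, s %/ p' + 1)]. The product of [m], [t] and the last entry is at most
    [Z], so each [(m, s')] leaves about [Z / m * l] pairs, and [s'] is one of the [tau (totient m)]
    divisors. *)
Lemma at_most_config_large (R : realFieldType) (X Y k e1 e2 S l : nat) :
  X < 2 ^ l -> 1 < S -> S <= Y ->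
  at_most R (fun n => exists m p m' p' s s' t,
      [/\ config X Y k e1 e2 m p m' p' s s' t, n = m * p & S <= s])
    ((2 * X)%:R / S%:R * l%:R * (1 + l%:R ^+ 4) ^+ k).
Proof.
move=> Xl S1 SY.
pose Z := (2 * X) %/ S.
have ZX : Z <= X by rewrite -[leqRHS](mulKn X (isT : 0 < 2)) leq_div2l.
pose ms := [seq m <- index_iota 1 Z.+1 | size (primes m) <= k].
pose mds := [seq (m, d) | m <- ms, d <- divisors (totient m)].
pose C := [seq (md, tq) | md <- mds, tq <- prod_le_pairs (Z %/ md.1)].
pose rel n (c : nat * nat * (nat * nat)) := exists p m' p' s,
  [/\ config X Y k e1 e2 c.1.1 p m' p' s c.1.2 c.2.1, n = c.1.1 * p & c.2.2 = (s %/ p').+1].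
apply: (at_most_le _ _ _ (size C)%:R _ (fun _ P => P)); last first.
  apply: (@at_most_code _ _ _ _ rel) => [n [m [p [m' [p' [s [s' [t [c nE Ss]]]]]]]]|].
    have [s0 s'0 t0] := config_gt0 c.
    exists (m, s', (t, (s %/ p').+1)); last by exists p, m', p', s.
    have m0 := config_m c; have mX := config_X c.
    have mst : m * t * s <= X.
      by rewrite (leq_trans _ mX) // (config_p c) mulnS -mulnA (mulnC t) leq_addl.
    have bound : S * (m * t * (s %/ p').+1) <= 2 * X.
      by apply: (leq_mul_succ_divn _ Y) => //; [exact: config_Yp' c | nia].
    have boundZ : m * t * (s %/ p').+1 <= Z by rewrite leq_divRL 1?mulnC // ltnW.
    apply/allpairsPdep; exists (m, s'), (t, (s %/ p').+1); split => //.
      apply/allpairsPdep; exists m, s'; split => //.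
        rewrite mem_filter (config_omega c) mem_index_iota1 m0 /=.
        by rewrite (leq_trans _ boundZ) // -mulnA leq_pmulr // muln_gt0 t0.
      rewrite -dvdn_divisors ?totient_gt0 // -(@Gauss_dvdl _ _ s).
        by rewrite (config_totient c) dvdn_mull.
      by rewrite coprime_sym (config_coprime c).
    by apply: mem_prod_le_pairs => //=; rewrite leq_divRL // mulnC mulnA.
  move=> n n' [[m s'] [t q]] [p [m' [p' [s [/= c -> ->]]]]].
  move=> [p1 [m1' [p1' [s1 [/= c1 -> []]]]]].
  have -> : p1' = p' by rewrite (config_p' c) (config_p' c1).
  move=> eq_q; rewrite (config_p c) (config_p c1).
  suff -> : s = s1 by [].
  have p'_pr := config_prime' c; have [_ s'0 t0] := config_gt0 c.
  (* Both sides are congruent to [e2] modulo [p']. *)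
  have eq_mod : m * p + e1 = m * p1 + e1 %[mod p'].
    rewrite (config_diff c) (config_diff c1).
    have -> : p1' = p' by rewrite (config_p' c) (config_p' c1).
    by rewrite !modnMDl.
  (* [p'] does not divide [m] because it does not divide [m * p], and [t < p'] since
     [p' = s' * t + 1]. *)
  have co_mt : coprime p' (m * t).
    rewrite prime_coprime // Euclid_dvdM // negb_or; apply/andP; split.
      by apply: contra (config_ndvd c); apply: dvdn_mulr.
    by apply/negP => /(dvdn_leq t0); rewrite (config_p' c) leqNgt ltnS leq_pmull.
  have {eq_mod} eq_mod : s == s1 %[mod p'].
    move/eqP: eq_mod; rewrite eqn_modDr (config_p c) (config_p c1) !mulnS !eqn_modDl.
    wlog le_s : s s1 {c c1 eq_q} / s <= s1.
      by move=> W; have [/W//|/ltnW/W {}W] := leqP s s1; rewrite eq_sym => /W; rewrite eq_sym.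
    have le_mst : m * (s * t) <= m * (s1 * t) by rewrite leq_mul2l leq_mul2r le_s !orbT.
    rewrite eq_sym (eqn_mod_dvd _ le_mst) => dvd_diff; rewrite eq_sym eqn_mod_dvd //.
    rewrite -(Gauss_dvdr _ co_mt); move: dvd_diff; congr (_ %| _).
    by rewrite -mulnBr -mulnBl -mulnA (mulnC t).
  by rewrite (divn_eq s p') (divn_eq s1 p') eq_q (eqP eq_mod).
rewrite size_allpairs_dep sumnE big_map natr_sum.
apply: (@le_trans _ _ (\sum_(md <- mds) (Z%:R * l%:R) / md.1%:R)%R).
  rewrite big_seq [leRHS]big_seq; apply: ler_sum => _ /allpairsPdep[m [d [mms _ ->]]] /=.
  move: mms; rewrite mem_filter mem_index_iota1 => /and3P[_ m0 _].
  apply: le_trans (size_prod_le_pairs R l _ _) _.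
    by rewrite (leq_ltn_trans _ Xl) // (leq_trans (leq_div _ _)).
  rewrite mulrAC ler_wpM2r ?ler0n // ler_pdivlMr ?ltr0n //.
  by rewrite -natrM ler_nat leq_trunc_div.
rewrite big_allpairs_dep /=.
have -> : (\sum_(m <- ms) \sum_(d <- divisors (totient m)) (Z%:R * l%:R) / m%:R =
    Z%:R * l%:R * \sum_(1 <= m < Z.+1 | (size (primes m) <= k)%N) (tau (totient m))%:R / m%:R :> R)%R.
  rewrite mulr_sumr big_filter; apply: eq_bigr => m _.
  by rewrite big_const_seq count_predT iter_addr_0 -[LHS]mulr_natr -/(tau _); ring.
apply: ler_pM; rewrite ?mulr_ge0 ?ler0n //.
- by apply: sumr_ge0 => m _; rewrite divr_ge0 ?ler0n.
- rewrite ler_wpM2r ?ler0n // ler_pdivlMr ?ltr0n 1?ltnW //.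
  by rewrite -natrM ler_nat leq_trunc_div.
- by apply: sum_tau_totient_le; apply: leq_ltn_trans Xl.
Qed.

(** The code is [(s, s', t, n %/ (p * p') + 1)]. Its first three entries give [p] and [p'], which
    are distinct; the residues of [n] modulo both are then fixed, and the Chinese remainder theorem
    applies. *)
Lemma at_most_config_balanced (R : realFieldType) (X Y k e1 e2 S l : nat) :
  X < 2 ^ l -> 1 < Y ->
  at_most R (fun n => exists m p m' p' s s' t,
      [/\ config X Y k e1 e2 m p m' p' s s' t, n = m * p, s < S & Y <= m])
    (S%:R ^+ 2 * ((2 * X)%:R / Y%:R * l%:R)).
Proof.
move=> Xl Y1.
pose Z := (2 * X) %/ Y.
have ZX : Z <= X by rewrite -[leqRHS](mulKn X (isT : 0 < 2)) leq_div2l.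
pose ss := [seq (s, s') | s <- iota 0 S, s' <- iota 0 S].
pose C := [seq (s, tq) | s <- ss, tq <- prod_le_pairs Z].
pose rel n (c : nat * nat * (nat * nat)) := exists m p m' p',
  [/\ config X Y k e1 e2 m p m' p' c.1.1 c.1.2 c.2.1, n = m * p & c.2.2 = (n %/ (p * p')).+1].
apply: (at_most_le _ _ _ (size C)%:R _ (fun _ P => P)); last first.
  apply: (@at_most_code _ _ _ _ rel) => [n [m [p [m' [p' [s [s' [t [c nE sS Ym]]]]]]]]|].
    have [s0 s'0 t0] := config_gt0 c; have mX := config_X c; have m0 := config_m c.
    exists (s, s', (t, (n %/ (p * p')).+1)); last by exists m, p, m', p'.
    have tp : t <= p by rewrite (config_p c) ltnW // ltnS leq_pmull.
    apply/allpairsPdep; exists (s, s'), (t, (n %/ (p * p')).+1); split => //.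
      apply/allpairsPdep; exists s, s'; rewrite !mem_iota sS.
      by rewrite (leq_ltn_trans (config_le c)).
    apply: mem_prod_le_pairs => //; rewrite leq_divRL; last exact: ltnW.
    (* The quotient of [n] by [p * p'] is [m %/ p'], and [t <= p] turns [m * p <= X] into the two
       bounds [t * Y <= X] and [t * m <= X]. *)
    rewrite nE divnMA mulnK ?prime_gt0 ?(config_prime c) // mulnC.
    have Ym' : t * Y <= X by nia.
    apply: (leq_mul_succ_divn _ Y) => //; first exact: config_Yp' c.
    by nia.
  move=> n n' [[s s'] [t q]] [m [p [m' [p' [/= c nE ->]]]]].
  move=> [m1 [p1 [m1' [p1' [/= c1 n'E []]]]]].
  have ep : p1 = p by rewrite (config_p c) (config_p c1).
  have ep' : p1' = p' by rewrite (config_p' c) (config_p' c1).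
  rewrite {}ep {}ep' in c1 n'E * => eq_q.
  rewrite (divn_eq n (p * p')) (divn_eq n' (p * p')) eq_q; congr (_ + _).
  have co : coprime p p'.
    rewrite coprime_sym prime_coprime ?(config_prime' c) //.
    by apply: contra (config_ndvd c); apply: dvdn_mull.
  apply/eqP; rewrite chinese_remainder //; apply/andP; split.
    by rewrite nE n'E !modnMl.
  rewrite -(eqn_modDr e1) nE n'E (config_diff c) (config_diff c1).
  by rewrite !modnMDl.
rewrite size_allpairs size_allpairs size_iota !natrM -expr2.
rewrite ler_wpM2l ?exprn_ge0 ?ler0n //.
apply: le_trans (size_prod_le_pairs R l _ (leq_ltn_trans ZX Xl)) _.
rewrite ler_wpM2r ?ler0n // ler_pdivlMr ?ltr0n 1?ltnW // -!natrM ler_nat.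
exact: leq_trunc_div.
Qed.

(* When m and m' are given, (p, p') solves a 2 x 2 linear system, whose determinant
   vanishes only if totient m / m = totient m' / m', which parity excludes. *)
Lemma at_most_config_small (R : realFieldType) (X Y k e1 e2 S : nat) : 2 < Y ->
  at_most R (fun n => exists m p m' p' s s' t,
      [/\ config X Y k e1 e2 m p m' p' s s' t, n = m * p, s < S & m < Y])
    (Y * (Y * e1.+1 * S).+1)%:R.
Proof.
move=> Y2.
pose C := [seq (m, m') | m <- iota 0 Y, m' <- iota 0 (Y * e1.+1 * S).+1].
pose rel n (c : nat * nat) := exists p p' s s' t,
  config X Y k e1 e2 c.1 p c.2 p' s s' t /\ n = c.1 * p.
have -> : Y * (Y * e1.+1 * S).+1 = size C by rewrite size_allpairs !size_iota.
apply: (@at_most_code _ _ _ _ rel) => [n [m [p [m' [p' [s [s' [t [c nE sS mY]]]]]]]]|].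
  have [s0 s'0 t0] := config_gt0 c; have m0 := config_m c.
  exists (m, m'); last by exists p, p', s, s', t.
  apply/allpairsPdep; exists m, m'; rewrite !mem_iota mY ltnS; split => //.
  have p'0 := prime_gt0 (config_prime' c); have p0 := prime_gt0 (config_prime c).
  have pp' : p <= S * p'.
    rewrite (config_p c) (config_p' c); apply: (@leq_trans (S * t.+1)); first by nia.
    by rewrite leq_mul2l ltnS leq_pmull ?orbT.
  (* This yields the range for [m']: [m' * p' <= m * p + e1 <= m * p * e1.+1], while [m < Y] and
     [p <= S * p']. *)
  suff : m' * p' <= Y * e1.+1 * S * p' by rewrite leq_pmul2r.
  apply: (@leq_trans (m * p * e1.+1)).
    have := config_diff c; have : 0 < m * p by rewrite muln_gt0 m0.
    by move: (m * p) (m' * p') => a b; nia.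
  apply: (@leq_trans (Y * (S * p') * e1.+1)); last by lia.
  by rewrite leq_mul2r /= leq_mul // ltnW.
move=> n n' [m m'] [p [p' [s [s' [t [/= c ->]]]]]] [p1 [p1' [s1 [s1' [t1 [/= c1 ->]]]]]].
have m0 := config_m c; have m'0 := config_m' c.
congr (_ * _); apply/eqP/negPn/negP => neq_p.
have /eqP eq_ratio : totient m * m' == totient m' * m.
  have lin := config_diff c; have lin1 := config_diff c1.
  have tot X' Y' k' f1 f2 n1 q n1' q' u u' v :
      config X' Y' k' f1 f2 n1 q n1' q' u u' v -> totient n1 * q.-1 = totient n1' * q'.-1.
    by move=> d; rewrite (config_p d) (config_p' d) /= !mulnA (config_totient d).
  have := tot _ _ _ _ _ _ _ _ _ _ _ _ c; have := tot _ _ _ _ _ _ _ _ _ _ _ _ c1.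
  have := prime_gt0 (config_prime c); have := prime_gt0 (config_prime' c).
  have := prime_gt0 (config_prime c1); have := prime_gt0 (config_prime' c1).
  move: lin lin1; clear tot c c1.
  move: (totient m) (totient m') => a a'.
  (* The variables now stand for the predecessors of the primes. Differences of the two solutions,
     taken in the integers, solve the homogeneous system, and the first difference is nonzero. *)
  case: p p' p1 p1' neq_p => [//|p] [//|p'] [//|p1] [//|p1'] /= neq_p lin lin1 _ _ _ _ eq1 eq0.
  have neq : (p%:Z - p1%:Z != 0)%R by rewrite subr_eq0; lia.
  rewrite -eqz_nat -(inj_eq (mulIf neq)); apply/eqP.
  have linZ : (m%:Z * (p%:Z - p1%:Z) = m'%:Z * (p'%:Z - p1'%:Z))%R by lia.
  have totZ : (a%:Z * (p%:Z - p1%:Z) = a'%:Z * (p'%:Z - p1'%:Z))%R by lia.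
  rewrite !PoszM.
  transitivity (m'%:Z * (a%:Z * (p%:Z - p1%:Z)))%R; first by ring.
  by rewrite totZ -[RHS]mulrA linZ; ring.
have eq_primes := eq_primes_totient_ratio m m' m0 m'0 eq_ratio.
(* As [Y > 2], the large primes are odd, so the parity of [m * p] is that of [m], which is read off
   from whether 2 is in [primes m]. *)
have odd_mp q v : 0 < v -> prime q -> Y <= q -> odd (v * q) = odd v.
  move=> v0 q_pr Yq; rewrite oddM; case: (even_prime q_pr) => [q2|->]; last exact: andbT.
  by move: Yq; rewrite q2 leqNgt Y2.
have odd_primes v : 0 < v -> odd v = (2 \notin primes v).
  by move=> v0; rewrite mem_primes v0 /= dvdn2 negbK.
have := config_odd c.
rewrite !odd_mp ?(config_prime c, config_prime' c, config_Yp c, config_Yp' c) //.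
by rewrite !odd_primes // eq_primes eqxx.
Qed.

Lemma config_exists (X Y k e1 e2 m p m' p' : nat) :
  prime p -> prime p' -> Y <= p -> Y <= p' -> 0 < m -> 0 < m' ->
  size (primes m) <= k -> ~~ (p' %| m * p) -> m * p + e1 = m' * p' + e2 ->
  odd (m * p) != odd (m' * p') -> coprime p m -> coprime p' m' ->
  totient (m * p) = totient (m' * p') -> p' <= p -> m * p <= X ->
  exists s s' t, config X Y k e1 e2 m p m' p' s s' t.
Proof.
move=> p_pr p'_pr Yp Yp' m0 m'0 mk ndvd diff odd_n co co' tot le_p mX.
have p1 := prime_gt1 p_pr; have p'1 := prime_gt1 p'_pr.
pose t := gcdn p.-1 p'.-1.
have t0 : 0 < t by rewrite gcdn_gt0; apply/orP; left; lia.
have pE : p = (p.-1 %/ t * t).+1 by rewrite divnK ?dvdn_gcdl //; lia.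
have p'E : p' = (p'.-1 %/ t * t).+1 by rewrite divnK ?dvdn_gcdr //; lia.
exists (p.-1 %/ t), (p'.-1 %/ t), t; split => //.
- apply/eqP; rewrite -(eqn_pmul2r t0) -!mulnA !divnK ?dvdn_gcdl ?dvdn_gcdr //.
  have totM q v : prime q -> coprime q v -> totient (v * q) = totient v * q.-1.
    by move=> q_pr qv; rewrite totient_coprime 1?coprime_sym // (totient_prime q_pr).
  by rewrite -!totM // tot.
- by rewrite /coprime -(eqn_pmul2r t0) muln_gcdl !divnK ?dvdn_gcdl ?dvdn_gcdr // mul1n.
- by rewrite leq_div2r //; lia.
Qed.

(** * Assembly of the combinatorial bound *)

Lemma at_most_config (R : realFieldType) (X Y k e1 e2 S l : nat) :
  X < 2 ^ l -> 1 < S -> S <= Y -> 2 < Y -> e1 < Y ->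
  at_most R (fun n => exists m p m' p' s s' t,
      config X Y k e1 e2 m p m' p' s s' t /\ n = m * p)
    ((2 * X)%:R / S%:R * l%:R * (1 + l%:R ^+ 4) ^+ k +
     (S%:R ^+ 2 * ((2 * X)%:R / Y%:R * l%:R) + (Y * (Y * Y * S).+1)%:R)).
Proof.
move=> Xl S1 SY Y2 e1Y.
have at_large := at_most_config_large R X Y k e1 e2 S l Xl S1 SY.
have at_bal := at_most_config_balanced R X Y k e1 e2 S l Xl (ltnW Y2).
have le_small : ((Y * (Y * e1.+1 * S).+1)%:R <= (Y * (Y * Y * S).+1)%:R :> R)%R.
  by rewrite ler_nat leq_mul2l ltnS leq_mul2r leq_mul2l e1Y !orbT.
have at_small := at_most_le _ _ _ _ _ (fun n P => P) le_small
  (at_most_config_small R X Y k e1 e2 S Y2).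
apply: (at_most_or _ _ _ _ _ _ _ at_large (at_most_or _ _ _ _ _ _ (fun n P => P) at_bal at_small)).
move=> n [m [p [m' [p' [s [s' [t [c nE]]]]]]]].
have [Ss|sS] := leqP S s; first by left; exists m, p, m', p', s, s', t; split.
right; have [Ym|mY] := leqP Y m; [left|right]; exists m, p, m', p', s, s', t; split => //.
Qed.

(** The summands are, in order: [n < W]; more than [k] primes; a large square divisor;
    configurations. The last three are doubled because they may concern [n] or [n + h]; for
    configurations the number counted is the one with the larger prime, so [(e1, e2)] is [(h, 0)] or
    [(0, h)]. *)
Lemma at_most_repeated_totient (R : realFieldType) (N h k j l S Y W : nat) :
  odd h -> h < Y -> 2 < Y -> 1 < S -> S <= Y -> N + h < 2 ^ l -> Y ^ (3 * k) < W ->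
  at_most R (fun n => 0 < n <= N /\ totient n = totient (n + h))
    (W%:R +
     (2%:R * ((N + h)%:R * l%:R ^+ (2 ^ j) / 2%:R ^+ (k * j)) +
      (2%:R * ((N + h)%:R * (2%:R / Y%:R)) +
       2%:R * ((2 * (N + h))%:R / S%:R * l%:R * (1 + l%:R ^+ 4) ^+ k +
        (S%:R ^+ 2 * ((2 * (N + h))%:R / Y%:R * l%:R) + (Y * (Y * Y * S).+1)%:R))))).
Proof.
move=> odd_h hY Y2 S1 SY Xl YW; have Y0 : 0 < Y by lia.
have h0 : 0 < h by case: h odd_h {hY Xl}.
set X := N + h in Xl *.
have twice (Q1 Q2 : nat -> Prop) b : at_most R Q1 b -> at_most R Q2 b ->
    at_most R (fun n => Q1 n \/ Q2 (n + h)) (2%:R * b).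
  move=> at1 at2; have -> : (2%:R * b = b + b)%R by ring.
  exact: at_most_or _ _ _ _ _ _ (fun n P => P) at1 (at_most_shift _ _ _ _ at2).
have atM := at_most_many_primes R k j l X Xl.
have atD := at_most_square_divisor R X Y Y0.
have atC := at_most_config R X Y k h 0 S l Xl S1 SY Y2 hY.
have atC' := at_most_config R X Y k 0 h S l Xl S1 SY Y2 Y0.
have at_W : at_most R (fun n => n < W) W%:R.
  move=> s us sW; rewrite ler_nat -[leqRHS](size_iota 0).
  by apply: uniq_leq_size => // n /sW; rewrite mem_iota.
apply: (at_most_or _ _ _ _ _ _ _ at_W (at_most_or _ _ _ _ _ _ (fun n P => P) (twice _ _ _ atM atM)
  (at_most_or _ _ _ _ _ _ (fun n P => P) (twice _ _ _ atD atD) (twice _ _ _ atC atC')))).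
move=> n [/andP[n0 nN] tot].
have nX : 0 < n <= X by rewrite n0 (leq_trans nN) ?leq_addr.
have nhX : 0 < n + h <= X by rewrite addn_gt0 n0 leq_add2r.
have [nW|Wn] := ltnP n W; [by left | right].
have [nk|nk] := ltnP k (size (primes n)); first by left; left.
have [nhk|nhk] := ltnP k (size (primes (n + h))); first by left; right.
have [sq|nsq] := pselect (exists2 d, Y <= d & d ^ 2 %| n); first by right; left; left.
have [sqh|nsqh] := pselect (exists2 d, Y <= d & d ^ 2 %| n + h).
  by right; left; right.
right; right.
have [||p [m [p_pr Yp nE co mk]]] := exists_large_prime_factor Y k n n0 nk.
+ exact: leq_trans YW Wn.
+ by move=> d Yd; apply/negP => dn; apply: nsq; exists d.
have nh0 : 0 < n + h by rewrite addn_gt0 n0.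
have [||p' [m' [p'_pr Yp' nhE co' mk']]] := exists_large_prime_factor Y k (n + h) nh0 nhk.
+ by apply: leq_trans (leq_trans YW Wn) _; rewrite leq_addr.
+ by move=> d Yd; apply/negP => dn; apply: nsqh; exists d.
have m0 : 0 < m by move: n0; rewrite nE muln_gt0 => /andP[].
have m'0 : 0 < m' by move: nh0; rewrite nhE muln_gt0 => /andP[].
(* A common divisor [q >= Y] of [n] and [n + h] would divide [h], which is positive and below
   [Y]. *)
have ndvd_h q : Y <= q -> q %| n -> q %| n + h -> False.
  by move=> Yq qn; rewrite dvdn_addr // => /(dvdn_leq h0); lia.
have odd_nh : odd n != odd (n + h) by rewrite oddD odd_h addbT; case: odd.
move: nX nhX => /andP[_ nX] /andP[_ nhX].
have [le_p|/ltnW le_p] := leqP p' p; [left|right].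
- have [s [s' [t c]]] : exists s s' t, config X Y k h 0 m p m' p' s s' t.
    apply: config_exists; rewrite -?nE -?nhE ?addn0 //.
    by apply/negP => /(ndvd_h _ Yp'); apply; rewrite nhE dvdn_mull.
  by exists m, p, m', p', s, s', t.
- have [s [s' [t c]]] : exists s s' t, config X Y k 0 h m' p' m p s s' t.
    apply: config_exists; rewrite -?nE -?nhE ?addn0 // 1?eq_sym //.
    by apply/negP; apply: (ndvd_h _ Yp); rewrite nE dvdn_mull.
  by exists m', p', m, p, s, s', t.
Qed.

Local Open Scope ring_scope.

(** * Choice of parameters and size of each term *)

(** The base inequality [expR (1 / 2) <= 2] is the inverse of [1 - 1 / 2 <= expR (- 1 / 2)]. *)
Lemma expR_half_le_exp2 (R : realType) (n : nat) : expR (n%:R / 2%:R) <= 2%:R ^+ n :> R.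
Proof.
rewrite expRM_natl lerXn2r ?nnegrE ?expR_ge0 ?ler0n //.
have := expR_ge1Dx (- 2%:R^-1 : R); rewrite expRN.
rewrite (_ : 1 + - 2%:R^-1 = 2%:R^-1); last by field.
by rewrite lef_pV2 ?posrE ?expR_gt0 ?ltr0n.
Qed.

Lemma exp2_le_expR (R : realType) (n : nat) : 2%:R ^+ n <= expR n%:R :> R.
Proof.
rewrite -[n%:R]mulr1 expRM_natl lerXn2r ?nnegrE ?expR_ge0 ?ler0n //.
by have := expR_ge1Dx (1 : R).
Qed.

Lemma truncn_succ_bounds (R : realType) (x : R) : 0 <= x ->
  x < (Num.truncn x).+1%:R /\ (Num.truncn x).+1%:R <= x + 1.
Proof.
by move=> x0; have /andP[le1 lt2] := truncn_itv x0; rewrite -{2}natr1 lerD2r.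
Qed.

Lemma exists_nat_ratio (R : realType) (w y : R) : 0 < w -> w <= y ->
  exists k : nat, y <= k%:R * w /\ k%:R * w <= 2 * y.
Proof.
move=> w0 wy; have y0 : 0 <= y by lra.
have [lt le] := truncn_succ_bounds _ _ (divr_ge0 y0 (ltW w0)).
exists (Num.truncn (y / w)).+1; move: (_.+1%:R) lt le => k lt le.
split; first by rewrite -ler_pdivrMr // ltW.
by apply: (le_trans (ler_wpM2r (ltW w0) le)); rewrite mulrDl mul1r divfK ?gt_eqF //; lra.
Qed.

Lemma exists_nat_half (R : realType) (y : R) : 1 <= y ->
  exists j : nat, y / 2 <= j%:R /\ j%:R <= y.
Proof.
move=> y1; have y0 : 0 <= y by lra.
have /andP[le lt] := truncn_itv y0; exists (Num.truncn y); split=> //.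
have : 1 <= (Num.truncn y)%:R :> R by rewrite ler1n truncn_gt0.
by move: lt; rewrite -natr1; lra.
Qed.

(** For [w = log log x] this supplies the [l] used in all sums up to [2 * x]; allowing [(log x) ^ 2]
    instead of a multiple of [log x] absorbs constants and rounding. *)
Lemma exists_exp2_gt (R : realType) (w : R) : 64 <= w ->
  exists l : nat, 2 * expR (expR w) < 2%:R ^+ l /\ l%:R <= expR (2 * w).
Proof.
move=> w64; have expw := expR_ge1Dx w; rewrite expRM_natl.
move: (expR w) expw => L Lw; have L0 : 0 <= 2 * L + 2 by lra.
have [lt le] := truncn_succ_bounds _ _ L0.
exists (Num.truncn (2 * L + 2)).+1; split; last by apply: (le_trans le); rewrite expr2; nra.
apply: lt_le_trans (expR_half_le_exp2 R _).
apply: (@le_lt_trans _ _ (expR (L + 1))).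
  by rewrite expRD mulrC ler_wpM2l ?expR_ge0 //; have := expR_ge1Dx (1 : R); lra.
by rewrite ltr_expR; lra.
Qed.

Lemma exists_nat_expR (R : realType) (g : R) : 2 <= g ->
  exists Q : nat, [/\ (2 < Q)%N, expR g < Q%:R & Q%:R <= expR (2 * g)].
Proof.
move=> g2; have expg := expR_ge1Dx g; rewrite expRM_natl.
have [lt le] := truncn_succ_bounds _ _ (expR_ge0 g).
exists (Num.truncn (expR g)).+1; split=> //.
  by rewrite -(ltr_nat R) (le_lt_trans _ lt) //; lra.
by apply: (le_trans le); rewrite expr2; move: (expR g) expg => e; nra.
Qed.

(** [expR (w / 2)] is [expR (w / 4)], at least 17, times two factors [expR (w / 8)], one of which is
    at least [1 + w / 8]; this produces [2 * w * expR (w / 8)]. *)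
Lemma expR_half_growth (R : realType) (w g : R) : 64 <= w -> expR (w / 2) <= g ->
  [/\ 2 * w * expR (w / 8) <= g, 2 * w <= g & 128 <= g].
Proof.
move=> w64.
have e8 : 1 + w / 8 <= expR (w / 8) by exact: expR_ge1Dx.
have e4 : 17 <= expR (w / 4) by apply: le_trans (expR_ge1Dx _); lra.
have -> : expR (w / 2) = expR (w / 4) * expR (w / 4) by rewrite -expRD; congr expR; field.
have e4E : expR (w / 4) = expR (w / 8) * expR (w / 8) by rewrite -expRD; congr expR; field.
move: (expR (w / 4)) (expR (w / 8)) e8 e4 e4E => a b e8 e4 e4E le_g.
have wbg : 2 * w * b <= g by nra.
by split=> //; nra.
Qed.

(** Here [calA x = o(log log x)] enters, with [v] for [calA x]: the exponent [18 * a * k * g] is at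
    most [36 * a * K * g ^ 2 / w = 36 * a * K * L * v / w <= L / 2]. *)
Lemma smooth_threshold_le (R : realType) (B g w L v : R) (K a k Q : nat) :
  0 < B -> 32 * (B + 1) <= K%:R -> B + 1 + 18 * K%:R <= a%:R -> 0 < g ->
  1 <= w -> Q%:R <= expR (2 * g) ->
  k%:R * w <= 2 * (K%:R * g) -> g ^+ 2 = L * v -> 72 * a%:R * K%:R * v <= w ->
  a%:R * g <= L / 80 -> (((Q ^ (3 * a)) ^ (3 * k)).+1)%:R <= 2 * (expR L * expR (- (B * g))).
Proof.
move=> B0 K32 aK g0 w1 Qg kw g2 vw gL.
have Bag : B * g <= a%:R * g by rewrite ler_wpM2r ?(ltW g0) //; lra.
have a0 : 0 <= a%:R * g by rewrite mulr_ge0 ?(ltW g0) //; lra.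
have L0 : 0 <= L by lra.
rewrite -expRD -natr1 -expnM natrX.
suff le_half : Q%:R ^+ (3 * a * (3 * k)) <= expR (L - B * g).
  by have : 1 <= expR (L - B * g); [rewrite -[leLHS]expR0 ler_expR; lra|lra].
apply: (@le_trans _ _ (expR (2 * g) ^+ (3 * a * (3 * k)))).
  by rewrite lerXn2r ?nnegrE ?expR_ge0.
rewrite -expRM_natl ler_expR !natrM.
suff : 18 * (a%:R * k%:R * g) <= L / 2 by lra.
have w0 : 0 < w by lra.
rewrite -(ler_pM2r w0).
apply: (@le_trans _ _ (18 * (a%:R * g) * (2 * (K%:R * g)))).
  rewrite (_ : 18 * _ * w = 18 * (a%:R * g) * (k%:R * w)); last by ring.
  by rewrite ler_wpM2l // mulr_ge0.
rewrite (_ : 18 * _ * _ = 36 * a%:R * K%:R * (L * v)); last by rewrite -g2; ring.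
rewrite (_ : 36 * _ * _ * _ = (72 * a%:R * K%:R * v) * (L / 2)); last by field.
by rewrite mulrC ler_wpM2l //; lra.
Qed.

(** The moment is at most [expR (2 * w * 2 ^ j) <= expR g]. Against it, [2 ^ (k * j)] is at least
    [expR (k * j / 2)], where [k * j >= K * g / 16 >= 2 * (B + 1) * g]; hence the 32 in the choice
    of [K]. *)
Lemma many_primes_le (R : realType) (B g w x X : R) (K j k l : nat) :
  0 < B -> 32 * (B + 1) <= K%:R -> 0 < g -> 0 <= X -> X <= 2 * x ->
  l%:R <= expR (2 * w) -> 0 <= w -> 2 * w * expR (w / 8) <= g -> j%:R <= w / 8 ->
  w / 16 <= j%:R -> K%:R * g <= k%:R * w ->
  X * l%:R ^+ (2 ^ j) / 2%:R ^+ (k * j) <= 2 * (x * expR (- (B * g))).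
Proof.
move=> B0 K32 g0 X0 Xx lw w0 wg j_le j_ge kw.
have lj : l%:R ^+ (2 ^ j) <= expR g.
  apply: (@le_trans _ _ (expR (2 * w) ^+ (2 ^ j))).
    by rewrite lerXn2r ?nnegrE ?expR_ge0.
  rewrite -expRM_natl ler_expR (le_trans _ wg) // mulrC ler_wpM2l //; first by lra.
  by rewrite natrX (le_trans (exp2_le_expR _ _)) // ler_expR.
have kj : (2%:R ^+ (k * j))^-1 <= expR (- ((B + 1) * g)).
  rewrite expRN lef_pV2 ?posrE ?expR_gt0 ?exprn_gt0 //.
  apply: le_trans (expR_half_le_exp2 R (k * j)); rewrite ler_expR natrM.
  have : k%:R * (w / 16) <= k%:R * j%:R by rewrite ler_wpM2l.
  have : 32 * (B + 1) * g <= K%:R * g by rewrite ler_wpM2r ?(ltW g0).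
  lra.
apply: (@le_trans _ _ (2 * x * expR g * expR (- ((B + 1) * g)))).
  by rewrite !ler_pM ?mulr_ge0 ?invr_ge0 ?exprn_ge0.
by rewrite -!mulrA -expRD; have -> : g + - ((B + 1) * g) = - (B * g) by ring.
Qed.

(** The [k]-th power is at most [expR (9 * w * k) <= expR (18 * K * g)] and [l <= expR g]; the
    saving [expR (- a * g)] from [S] must beat both and leave [B], whence the condition on [a]. *)
Lemma large_config_le (R : realType) (B g w x X S : R) (K a k l : nat) :
  B + 1 + 18 * K%:R <= a%:R -> 0 < g -> 0 <= X -> X <= 2 * x ->
  0 < S -> expR (a%:R * g) <= S -> 1 <= w -> 2 * w <= g ->
  l%:R <= expR (2 * w) -> k%:R * w <= 2 * (K%:R * g) ->
  2 * X / S * l%:R * (1 + l%:R ^+ 4) ^+ k <= 4 * (x * expR (- (B * g))).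
Proof.
move=> aK g0 X0 Xx S0 aS w1 wg lw kw.
have SV : S^-1 <= expR (- (a%:R * g)) by rewrite expRN lef_pV2 ?posrE ?expR_gt0.
have lg : l%:R <= expR g by apply: (le_trans lw); rewrite ler_expR.
have l4 : 1 + l%:R ^+ 4 <= expR (9 * w).
  apply: (@le_trans _ _ (2 * expR (8 * w))).
    have : l%:R ^+ 4 <= expR (8 * w).
      rewrite (_ : 8 * w = 4%:R * (2 * w)); last by ring.
      by rewrite expRM_natl lerXn2r ?nnegrE ?expR_ge0.
    by have : 1 <= expR (8 * w); [rewrite -[leLHS]expR0 ler_expR|]; lra.
  rewrite (_ : 9 * w = w + 8 * w); last by ring.
  by rewrite expRD ler_wpM2r ?expR_ge0 //; have := expR_ge1Dx w; lra.
have lk : (1 + l%:R ^+ 4) ^+ k <= expR (18 * K%:R * g).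
  apply: (@le_trans _ _ (expR (9 * w) ^+ k)).
    by rewrite lerXn2r ?nnegrE ?expR_ge0 // addr_ge0 ?exprn_ge0.
  by rewrite -expRM_natl ler_expR; lra.
apply: (@le_trans _ _ (4 * x * expR (- (a%:R * g)) * expR g * expR (18 * K%:R * g))).
  have X2 : 0 <= 2 * X by lra.
  have X4 : 2 * X <= 4 * x by lra.
  move: (2 * X) X2 X4 => X' X'0 X'x.
  by rewrite !ler_pM ?mulr_ge0 ?invr_ge0 ?(ltW S0) ?exprn_ge0 ?addr_ge0 ?exprn_ge0.
rewrite -!mulrA -!expRD ler_wpM2l // ler_wpM2l //; first by lra.
rewrite ler_expR.
have : (B + 1 + 18 * K%:R) * g <= a%:R * g by rewrite ler_wpM2r ?(ltW g0).
lra.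
Qed.

Lemma inv_le_expRN (R : realType) (c S : R) : 0 < S -> expR c <= S -> S^-1 <= expR (- c).
Proof. by move=> S0 cS; rewrite expRN lef_pV2 ?posrE ?expR_gt0. Qed.

Lemma square_divisor_le (R : realType) (B g x X S : R) (a : nat) :
  B <= a%:R -> 0 < g -> 0 <= X -> X <= 2 * x -> 1 <= S -> expR (a%:R * g) <= S ->
  X * (2 / S ^+ 3) <= 4 * (x * expR (- (B * g))).
Proof.
move=> Ba g0 X0 Xx S1 aS; have S0 : 0 < S by lra.
have : (S ^+ 3)^-1 <= expR (- (B * g)).
  apply: (@le_trans _ _ S^-1).
    by rewrite lef_pV2 ?posrE ?exprn_gt0 // -{1}[S]expr1 ler_weXn2l.
  apply: (le_trans (inv_le_expRN _ _ _ S0 aS)).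
  by rewrite ler_expR lerN2 ler_wpM2r // ltW.
have : 0 <= (S ^+ 3)^-1 by rewrite invr_ge0 exprn_ge0 // ltW.
move: (_^-1) (expR _) => u e u0 ue.
have : X * u <= 2 * x * e by rewrite ler_pM.
by rewrite mulrCA -!mulrA; lra.
Qed.

(** With [Y = S ^ 3], paying [S ^ 2] for the pairs [(s, s')] still leaves a saving of [S]. *)
Lemma balanced_config_le (R : realType) (B g x X S : R) (a l : nat) :
  B + 1 <= a%:R -> 0 < g -> 0 <= X -> X <= 2 * x -> 1 <= S -> expR (a%:R * g) <= S ->
  l%:R <= expR g ->
  S ^+ 2 * (2 * X / S ^+ 3 * l%:R) <= 4 * (x * expR (- (B * g))).
Proof.
move=> Ba g0 X0 Xx S1 aS lg; have S0 : 0 < S by lra.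
rewrite (_ : _ * _ = 2 * (X * (S^-1 * l%:R))); last by field; lra.
have : X * (S^-1 * l%:R) <= 2 * x * expR (- (B * g)).
  rewrite ler_pM ?mulr_ge0 ?invr_ge0 ?(ltW S0) //.
  apply: (@le_trans _ _ (expR (- (a%:R * g)) * expR g)).
    by rewrite ler_pM ?invr_ge0 ?(ltW S0) // inv_le_expRN.
  rewrite -expRD ler_expR.
  have : (B + 1) * g <= a%:R * g by rewrite ler_wpM2r ?(ltW g0).
  by lra.
by rewrite -!mulrA; lra.
Qed.

(** Up to a factor 2 for the successor, the left side is [Y ^ 3 * S = Q ^ (10 * a)], at most
    [expR (20 * a * g) <= expR (L / 4)]. *)
Lemma small_config_le (R : realType) (B g L : R) (a Q : nat) : (0 < Q)%N ->
  Q%:R <= expR (2 * g) -> B <= a%:R -> 0 < g -> 80 * (a%:R * g) <= L ->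
  (Q ^ (3 * a) * (Q ^ (3 * a) * Q ^ (3 * a) * Q ^ a).+1)%:R <=
    2 * (expR L * expR (- (B * g))).
Proof.
move=> Q0 Qg Ba g0 gL.
have Bag : B * g <= a%:R * g by rewrite ler_wpM2r ?(ltW g0).
have ag0 : 0 <= a%:R * g by rewrite mulr_ge0 ?(ltW g0).
apply: (@le_trans _ _ (2 * (Q ^ (10 * a))%:R)).
  rewrite -natrM ler_nat (_ : 10 * a = 3 * a + (3 * a + (3 * a + a)))%N; last by lia.
  rewrite !expnD; have : (0 < Q ^ (3 * a))%N by rewrite expn_gt0 Q0.
  have : (0 < Q ^ a)%N by rewrite expn_gt0 Q0.
  move: (Q ^ (3 * a))%N (Q ^ a)%N => y s s0 y0.
  rewrite [leqRHS]mulnCA leq_mul2l -mulnA; apply/orP; right.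
  have : (0 < y * (y * s))%N by rewrite !muln_gt0 y0 s0.
  by lia.
rewrite ler_wpM2l // natrX -expRD.
apply: (@le_trans _ _ (expR (2 * g) ^+ (10 * a))).
  by rewrite lerXn2r ?nnegrE ?expR_ge0.
by rewrite -expRM_natl ler_expR natrM; lra.
Qed.

(* Parameters: S = Q ^ a and Y = Q ^ (3 * a) with Q ~ exp g, k ~ K * g / w,
   j ~ w / 8 and l ~ 2 * log x, where w = log log x. *)
Lemma at_most_repeated_totient_expR (R : realType) (B w v g : R) (K a h : nat) :
  0 < B -> 32 * (B + 1) <= K%:R -> B + 1 + 18 * K%:R <= a%:R ->
  64 <= w -> 1 <= v -> expR (w / 2) <= g -> g ^+ 2 = expR w * v ->
  72 * a%:R * K%:R * v <= w -> 80 * (a%:R * g) <= expR w ->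
  odd h -> h%:R <= expR (a%:R * g) ->
  at_most R (fun n => (0 < n <= Num.truncn (expR (expR w)))%N /\
                      totient n = totient (n + h))
    (34 * (expR (expR w) * expR (- (B * g)))).
Proof.
move=> B0 K32 aK w64 v1 le_g g2 vw gL odd_h hle.
have [wg w2g g128] := expR_half_growth _ _ _ w64 le_g.
have g0 : 0 < g by lra.
have K1 : 1 <= K%:R :> R by lra.
have Ba : B + 1 <= a%:R by lra.
have a0 : (0 < a)%N by rewrite -(ltr0n R); lra.
have [Q [Q2 gQ Qg]] : exists Q : nat, [/\ (2 < Q)%N, expR g < Q%:R & Q%:R <= expR (2 * g)].
  by apply: exists_nat_expR; lra.
have [l [l_gt l_le]] := exists_exp2_gt _ _ w64.
have [k [k_ge k_le]] : exists k : nat, K%:R * g <= k%:R * w /\ k%:R * w <= 2 * (K%:R * g).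
  by apply: exists_nat_ratio; nra.
have [j [j_ge j_le]] : exists j : nat, w / 8 / 2 <= j%:R /\ j%:R <= w / 8.
  by apply: exists_nat_half; lra.
have l_g : l%:R <= expR g by apply: (le_trans l_le); rewrite ler_expR.
have ag_L : a%:R * g <= expR w by have := expR_ge0 w; lra.
set L := expR w in g2 gL l_gt ag_L *; set x := expR L in l_gt *.
set N := Num.truncn x.
have Q0 : (0 < Q)%N by exact: leq_trans Q2.
have aS : expR (a%:R * g) < (Q ^ a)%:R.
  by rewrite natrX expRM_natl ltrXn2r ?nnegrE ?expR_ge0 // -lt0n.
have S1 : (1 < Q ^ a)%N by rewrite -(exp1n a) ltn_exp2r // ltnW.
have SY : (Q ^ a <= Q ^ (3 * a))%N by rewrite leq_pexp2l // leq_pmull.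
have Y2 : (2 < Q ^ (3 * a))%N.
  by rewrite (leq_trans Q2) // (leq_trans _ SY) // -{1}(expn1 Q) leq_pexp2l.
have hY : (h < Q ^ (3 * a))%N.
  by rewrite (leq_trans _ SY) // -(ltr_nat R) (le_lt_trans hle).
have Xx : (N + h)%:R <= 2 * x.
  have hx : h%:R <= x by apply: (le_trans hle); rewrite ler_expR.
  have Nx : N%:R <= x by rewrite truncn_le ?expR_ge0.
  by rewrite natrD; lra.
have Xl : (N + h < 2 ^ l)%N by rewrite -(ltr_nat R) natrX; apply: le_lt_trans l_gt.
have YE : (Q ^ (3 * a))%:R = (Q ^ a)%:R ^+ 3 :> R by rewrite mulnC expnM natrX.
apply: (at_most_le _ _ _ _ _ (fun n P => P) _ (at_most_repeated_totient R N h k j l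
  (Q ^ a) (Q ^ (3 * a)) ((Q ^ (3 * a)) ^ (3 * k)).+1 odd_h hY Y2 S1 SY Xl (leqnn _))).
have X0 : 0 <= (N + h)%:R :> R by [].
have S1R : 1 <= (Q ^ a)%:R :> R by rewrite ler1n ltnW.
have S0R : 0 < (Q ^ a)%:R :> R by rewrite ltr0n ltnW.
have w1 : 1 <= w by lra.
have w0 : 0 <= w by lra.
have gL80 : a%:R * g <= L / 80 by lra.
have Ba' : B <= a%:R by lra.
have j_ge' : w / 16 <= j%:R by lra.
have t1 := smooth_threshold_le _ _ _ _ _ _ _ _ _ _ B0 K32 aK g0 w1 Qg k_le g2 vw gL80.
have t2 := many_primes_le _ _ _ _ _ _ _ _ _ _ B0 K32 g0 X0 Xx l_le w0 wg j_le j_ge' k_ge.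
have t3 := square_divisor_le _ _ _ _ _ _ _ Ba' g0 X0 Xx S1R (ltW aS).
have t4 := large_config_le _ _ _ _ _ _ _ _ _ _ _ aK g0 X0 Xx S0R (ltW aS) w1 w2g l_le k_le.
have t5 := balanced_config_le _ _ _ _ _ _ _ _ Ba g0 X0 Xx S1R (ltW aS) l_g.
have t6 := small_config_le _ _ _ _ _ _ Q0 Qg Ba' g0 gL.
rewrite -/x in t1 t6; rewrite YE [(2 * (N + h))%:R]natrM.
move: (x * expR (- (B * g))) t1 t2 t3 t4 t5 t6 => M t1 t2 t3 t4 t5 t6.
(* The constant 34 collects the six term bounds, with the doublings for [n] and [n + h]. *)
rewrite (_ : 34 * M = 2 * M + (2 * (2 * M) + (2 * (4 * M) + 2 * (4 * M + (4 * M + 2 * M))))).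
  by rewrite !lerD ?ler_wpM2l ?lerD.
by ring.
Qed.

(** * Growth of [calA] and [bigG], and conclusion *)

Lemma Sphi_le (R : realType) (h : nat) (x b : R) :
  at_most R (fun n => (0 < n <= Num.truncn x)%N /\ totient n = totient (n + h)) b ->
  (Sphi h x)%:R <= b.
Proof.
rewrite /Sphi cardE -(size_map val); apply.
  by rewrite map_inj_uniq ?enum_uniq //; exact: val_inj.
move=> _ /mapP[n nA ->]; move: nA; rewrite mem_enum inE => /andP[n0 /eqP tot].
by rewrite n0 -ltnS ltn_ord.
Qed.

Lemma ln_ln_growth (R : realType) (e : R) : 0 < e ->
  exists w0 : R, forall w : R, w0 <= w ->
    1 <= ln w + ln (ln w) - ln 2 /\ ln w + ln (ln w) - ln 2 <= e * w.
Proof.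
(* With [u = ln w], the threshold gives [u >= expR 1], so that [ln u >= 1], and [u >= 4 / e], so
   that [2 * u <= e * (u ^ 2 / 2) <= e * w]. *)
move=> e0; exists (expR (Num.max (expR 1) (4 / e))) => w w0w.
have w0 : 0 < w by apply: lt_le_trans w0w; exact: expR_gt0.
have [le1 le2] : expR 1 <= ln w /\ 4 / e <= ln w.
  by apply/andP; rewrite -ge_max -ler_expR lnK ?posrE.
rewrite [X in e * X](_ : w = expR (ln w)); last by rewrite lnK ?posrE.
have u0 : 0 < ln w by apply: lt_le_trans le1; exact: expR_gt0.
have ln2_le : ln 2 <= 1 :> R by have := @le_ln1Dx R 1; apply; lra.
have ln2_ge : 0 <= ln 2 :> R by rewrite ln_ge0 //; lra.
have lnu_ge : 1 <= ln (ln w) by rewrite -[leLHS]expRK ler_ln ?posrE ?expR_gt0.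
have lnu_le : ln (ln w) <= ln w by rewrite ltW // ln_sublinear.
have := @expR_ge1Dxn R (ln w) 1 (ltW u0).
move: (ln w) (expR (ln w)) (ln (ln w)) le1 le2 u0 lnu_ge lnu_le => u E lu le1 le2 u0 lu1 luu Eu.
rewrite ler_pdivrMr // in le2.
move: (ln 2) ln2_le ln2_ge => l2 ln2_le ln2_ge.
have {}Eu : u ^+ 2 / 2 <= E by apply: le_trans Eu; rewrite (_ : 2`! = 2)%N // lerDr.
have e1 := expR_ge1Dx (1 : R).
split; first by lra.
apply: (@le_trans _ _ (2 * u)); first by lra.
apply: (@le_trans _ _ (e * (u ^+ 2 / 2))); last by rewrite ler_wpM2l // ltW.
have : 0 <= u * (u * e - 4) by rewrite mulr_ge0 ?(ltW u0) // subr_ge0.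
by rewrite expr2; lra.
Qed.

Lemma bigG_growth (R : realType) (e T : R) : 0 < e ->
  \forall x \near +oo, exists w, [/\ x = expR (expR w), T <= w, 1 <= calA x <= e * w,
    expR (w / 2) <= bigG x & bigG x ^+ 2 = expR w * calA x].
Proof.
move=> e0; have [w0 growth] := ln_ln_growth _ _ e0; near=> x.
have x_gt : expR (expR (Num.max w0 T)) <= x.
  by near: x; apply: nbhs_pinfty_ge; exact: num_real.
have x0 : 0 < x by apply: lt_le_trans x_gt; exact: expR_gt0.
have lnx_gt : expR (Num.max w0 T) <= ln x by rewrite -ler_expR lnK.
have lnx0 : 0 < ln x by apply: lt_le_trans lnx_gt; exact: expR_gt0.
have : Num.max w0 T <= ln (ln x) by rewrite -ler_expR lnK.
rewrite ge_max => /andP[w0w Tw]; have [v1 vw] := growth _ w0w.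
rewrite -/(calA x) in v1 vw.
have v0 : 0 <= calA x by lra.
have g2 : bigG x ^+ 2 = expR (ln (ln x)) * calA x.
  by rewrite lnK // sqr_sqrtr // mulr_ge0 // ltW.
exists (ln (ln x)); split=> //; [by rewrite !lnK|by rewrite v1|].
rewrite -(@ler_pXn2r _ 2) ?nnegrE ?expR_ge0 ?sqrtr_ge0 // g2 -expRM_natl.
rewrite (_ : 2%:R * (_ / 2) = ln (ln x)); last by field.
by rewrite ler_peMr ?expR_ge0.
Unshelve. all: by end_near.
Qed.

(** Both halves of the theorem follow: the range of [h] contains any fixed [h] once [x] is large,
    and it contains the range with [bigG x / Num.sqrt J] as [J >= 1]. *)
Lemma Sphi_bound_near (R : realType) (B : R) : 0 < B ->
  \forall x \near +oo, forall h : nat, odd h -> h%:R <= expR (bigG x) ->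
    (Sphi h x)%:R <= 34 * (x * expR (- (B * bigG x))).
Proof.
move=> B0.
have [K K32] : exists K : nat, 32 * (B + 1) <= K%:R.
  exists (Num.truncn (32 * (B + 1))).+1; apply/ltW.
  by have [] := truncn_succ_bounds _ (32 * (B + 1)); lra.
have K1 : 32 <= K%:R :> R by lra.
have [a aK] : exists a : nat, B + 1 + 18 * K%:R <= a%:R.
  exists (Num.truncn (B + 1 + 18 * K%:R)).+1; apply/ltW.
  by have [] := truncn_succ_bounds _ (B + 1 + 18 * K%:R); lra.
have a1 : 1 <= a%:R :> R by lra.
have c0 : 0 < 72 * a%:R * K%:R :> R by rewrite !mulr_gt0 //; lra.
have c1 : 1 <= 72 * a%:R * K%:R :> R by nra.
have [b bE] : exists b : R, b = 80 * a%:R by exists (80 * a%:R).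
have b0 : 0 <= b by rewrite bE mulr_ge0.
near=> x => h odd_h hle.
have [w [xE Tw /andP[v1 vw] le_g g2]] : exists w, [/\ x = expR (expR w),
    64 + 2 * b ^+ 2 <= w, 1 <= calA x <= (72 * a%:R * K%:R)^-1 * w,
    expR (w / 2) <= bigG x & bigG x ^+ 2 = expR w * calA x].
  by near: x; apply: bigG_growth; rewrite invr_gt0.
have bb0 : 0 <= b ^+ 2 by rewrite exprn_ge0.
have w64 : 64 <= w by lra.
have w0 : 0 <= w by lra.
have {}vw : 72 * a%:R * K%:R * calA x <= w.
  by move: vw; rewrite [X in _ <= X]mulrC ler_pdivlMr // mulrC.
have vw1 : calA x <= w by apply: le_trans vw; rewrite ler_peMl //; lra.
have L2 : w ^+ 2 / 2 <= expR w.
  by apply: le_trans (@expR_ge1Dxn R w 1 w0); rewrite (_ : 2`! = 2)%N // lerDr.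
(* After squaring, this asks for [b ^ 2 * calA x <= expR w], which follows from [2 * b ^ 2 <= w],
   [calA x <= w] and [w ^ 2 / 2 <= expR w]; hence the threshold on [w]. *)
have gL : 80 * (a%:R * bigG x) <= expR w.
  rewrite mulrA -bE -(@ler_pXn2r _ 2) ?nnegrE ?expR_ge0 ?mulr_ge0 ?sqrtr_ge0 //.
  rewrite exprMn g2 mulrCA [leRHS]expr2 ler_wpM2l ?expR_ge0 //; apply: le_trans L2.
  have : 2 * b ^+ 2 * calA x <= w * w by rewrite ler_pM //; lra.
  by rewrite -expr2; lra.
apply: Sphi_le; rewrite [in Num.truncn _]xE [X in X * expR _]xE.
apply: (at_most_repeated_totient_expR _ B w (calA x) _ K a h) => //.
by apply: (le_trans hle); rewrite ler_expR ler_peMl // sqrtr_ge0.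
Unshelve. all: by end_near.
Qed.

Local Open Scope classical_set_scope.

Theorem corollary1p2 (R : realType) :
  (forall (B : R) (h : nat), 0 < B -> (0 < h)%N -> odd h ->
     exists2 C : R, 0 < C &
       \forall x \near +oo,
         (Sphi h x)%:R <= C * (x * expR (- (B * bigG x)))) /\
  (forall (B : R) (J : int), 0 < B -> B ^+ 2 < J%:~R ->
     exists2 C : R, 0 < C &
       \forall x \near +oo, forall h : nat,
         (0 < h)%N -> odd h -> h%:R <= expR (bigG x / Num.sqrt J%:~R) ->
         (Sphi h x)%:R <= C * (x * expR (- (B * bigG x)))).
Proof.
split=> [B h B0 _ odd_h|B J B0 BJ]; exists 34; rewrite ?ltr0n //;
  have bound := Sphi_bound_near _ _ B0.
(* With [w >= 2 * h], [expR (bigG x) >= 1 + bigG x >= 1 + expR (w / 2) >= 2 + w / 2] exceeds [h]. *)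
- have growth := bigG_growth _ 1 (2 * h%:R) (@ltr01 R).
  apply: filterS2 bound growth => x bound_x [w [_ hw _ le_g _]]; apply: bound_x => //.
  by have := expR_ge1Dx (bigG x); have := expR_ge1Dx (w / 2); lra.
- apply: filterS bound => x bound_x h _ odd_h hle; apply: bound_x => //.
  apply: (le_trans hle); rewrite ler_expR ler_piMr ?sqrtr_ge0 //.
  have J1 : 1 <= J%:~R :> R.
    rewrite -[leLHS]/(1%:~R) ler_int -gtz0_ge1 -(ltr0z R).
    by apply: le_lt_trans BJ; rewrite sqr_ge0.
  have s1 : 1 <= Num.sqrt J%:~R :> R by rewrite -[leLHS]sqrtr1 ler_wsqrtr.
  by rewrite invf_le1 // (lt_le_trans ltr01).
Qed.
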